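(* Let $\mathcal{A}\in\mathbb{K}_l^{m\times r}$, $\mathcal{B}\in\mathbb{K}_l^{s\times n}$, $\mathcal{C}\in\mathbb{K}_l^{m\times n}$, let $\mathcal{M}\in\mathbb{K}_l^{r\times r}$ and $\mathcal{N}\in\mathbb{K}_l^{s\times s}$ be T-symmetric T-positive definite, and let $\mathcal{S}_1,\dots,\mathcal{S}_{q_{\mathcal{S}}}\in\mathbb{K}_l^{m\times\tau}$, $\mathcal{V}_1,\dots,\mathcal{V}_{q_{\mathcal{V}}}\in\mathbb{K}_l^{n\times\zeta}$ be given sketching tubal matrices. Let $\mathbf{u}_{\mathcal{S}}=(\frac1{q_{\mathcal{S}}},\dots,\frac1{q_{\mathcal{S}}})^T\in\Delta_{q_{\mathcal{S}}}$, $\mathbf{u}_{\mathcal{V}}=(\frac1{q_{\mathcal{V}}},\dots,\frac1{q_{\mathcal{V}}})^T\in\Delta_{q_{\mathcal{V}}}$, and $$\mathcal{R}:=\mathbf{Range}\big(((\mathcal{N}^{-1})^{ST}*\mathcal{B}^{R})\otimes_t(\mathcal{M}^{-1}*\mathcal{A}^{T})\big).$$ Let $\mathcal{X}^{\star}$ satisfy $\mathcal{A}*\mathcal{X}^{\star}*\mathcal{B}=\mathcal{C}$. Let $\{\mathcal{X}^t\}_{t=1}^{\infty}$ be the iteration sequence calculated by the ATESP-PR method with initial iteration $\mathcal{X}^0$ satisfying $\mathrm{vec}_t(\mathcal{X}^{0})\in\mathcal{R}$: with $f_{i,j}(\mathcal{X})=\|\mathcal{A}*\mathcal{X}*\mathcal{B}-\mathcal{C}\|_{F(\mathcal{E}_i,\mathcal{G}_j)}^{2}$,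 at step $t$, the pair $(i^t,j^t)$ is drawn equal to $(i,j)$ with probability $$p_{i,j}^{t}=\frac{f_{i,j}(\mathcal{X}^{t})}{\sum_{i'=1}^{q_{\mathcal{S}}}\sum_{j'=1}^{q_{\mathcal{V}}}f_{i',j'}(\mathcal{X}^{t})},$$ and $\mathcal{X}^{t+1}=\mathcal{X}^{t}-\mathcal{M}^{-1}*\mathcal{A}^{T}*\mathcal{E}_{i^t}*(\mathcal{A}*\mathcal{X}^{t}*\mathcal{B}-\mathcal{C})*\mathcal{G}_{j^t}*\mathcal{B}^{T}*\mathcal{N}^{-1}$. Let $$\delta_{\mathbf{u}_{\mathcal{S}},\mathbf{u}_{\mathcal{V}}}^{2}=\min_{0\neq\overrightarrow{\mathcal{Y}}\in\mathcal{R}}\frac{\|((\mathcal{N}^{\frac12})^{ST}\otimes_t\mathcal{M}^{\frac12})*\overrightarrow{\mathcal{Y}}\|^{2}_{\mathbb{E}_{j\sim\mathbf{u}_{\mathcal{V}}}[\mathcal{W}_j^{ST}]\otimes_t\mathbb{E}_{i\sim\mathbf{u}_{\mathcal{S}}}[\mathcal{Z}_i]}}{\|\overrightarrow{\mathcal{Y}}\|^{2}_{\mathcal{N}^{ST}\otimes_t\mathcal{M}}}.$$ Then $$\mathbb{E}\left[\|\mathcal{X}^{t+1}-\mathcal{X}^{\star}\|_{F(\mathcal{M},\mathcal{N})}^{2}\mid\mathcal{X}^{t}\right]\le\rho_{\text{ATESP-PR}}\,\|\mathcal{X}^{t}-\mathcal{X}^{\star}\|_{F(\mathcal{M},\mathcal{N})}^{2},$$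 where $$\rho_{\text{ATESP-PR}}=1-\big(1+q_{\mathcal{S}}^{2}q_{\mathcal{V}}^{2}\,\mathbf{Var}_{i\sim\mathbf{u}_{\mathcal{S}},j\sim\mathbf{u}_{\mathcal{V}}}[p_{i,j}^{t}]\big)\delta_{\mathbf{u}_{\mathcal{S}},\mathbf{u}_{\mathcal{V}}}^{2}.$$ Furthermore, $$\mathbb{E}\left[\|\mathcal{X}^{t+1}-\mathcal{X}^{\star}\|_{F(\mathcal{M},\mathcal{N})}^{2}\mid\mathcal{X}^{1}\right]\le\Big(\prod_{d=1}^{t}\rho_d\Big)\,\mathbb{E}\left[\|\mathcal{X}^{1}-\mathcal{X}^{\star}\|_{F(\mathcal{M},\mathcal{N})}^{2}\mid\mathcal{X}^{0}\right],\qquad \rho_d=1-\Big(1+\frac{|\Omega_d|}{q_{\mathcal{S}}q_{\mathcal{V}}}\Big)\delta_{\mathbf{u}_{\mathcal{S}},\mathbf{u}_{\mathcal{V}}}^{2},$$ where $\Omega_d=\{(i,j): f_{i,j}(\mathcal{X}^{d})=0,\ 1\le i\le q_{\mathcal{S}},\ 1\le j\le q_{\mathcal{V}}\}$ and $|\Omega_d|$ denotes its cardinality, for $d=1,\dots,t$.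
   Context: Fix $l\ge 1$. $\mathbb{K}_l^{m\times n}=\mathbb{R}^{m\times n\times l}$ (tubal matrices), $\mathbb{K}_l^{m}=\mathbb{K}_l^{m\times 1}$. $\mathcal{A}_{(k)}$ is the $k$-th frontal slice $\mathcal{A}(:,:,k)$. $\mathrm{unfold}(\mathcal{A})$ is the block column with blocks $\mathcal{A}_{(1)},\dots,\mathcal{A}_{(l)}$, $\mathrm{fold}$ is its inverse, and $\mathrm{bcirc}(\mathcal{A})$ is the block circulant matrix whose first block column is $\mathrm{unfold}(\mathcal{A})$ (block $(p,q)$ is $\mathcal{A}_{(((p-q)\bmod l)+1)}$). The t-product is $\mathcal{A}*\mathcal{B}=\mathrm{fold}(\mathrm{bcirc}(\mathcal{A})\,\mathrm{unfold}(\mathcal{B}))$. The identity $\mathcal{I}_n$ has first frontal slice the identity matrix and other slices zero; $\mathcal{A}^{-1}$ is the two-sided inverse with respect to $*$. Transpose: $(\mathcal{A}^{T})_{(1)}=\mathcal{A}_{(1)}^{T}$, $(\mathcal{A}^{T})_{(k)}=\mathcal{A}_{(l-k+2)}^{T}$ for $k\ge2$. Slice transpose: $(\mathcal{A}^{ST})_{(k)}=\mathcal{A}_{(k)}^{T}$ for all $k$. Reverse: $(\mathcal{A}^{R})_{(1)}=\mathcal{A}_{(1)}$, $(\mathcal{A}^{R})_{(k)}=\mathcal{A}_{(l-k+2)}$ for $k\ge2$. $\mathcal{A}^{\dag}$ is the unique Moore–Penrose inverse (the four Penrose equations with $*$ and ${}^T$). $\langle\cdot,\cdot\rangle$ is the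 entrywise inner product. $\mathcal{M}$ is T-symmetric if $\mathcal{M}=\mathcal{M}^{T}$, and T-symmetric T-positive (semi)definite if moreover $\langle\overrightarrow{\mathcal{X}},\mathcal{M}*\overrightarrow{\mathcal{X}}\rangle>0$ for all nonzero $\overrightarrow{\mathcal{X}}$ (resp. $\ge0$ for all $\overrightarrow{\mathcal{X}}$). $\mathcal{M}^{\frac12}$ is defined by $\mathrm{bcirc}(\mathcal{M}^{\frac12})=\mathrm{bcirc}(\mathcal{M})^{\frac12}$, and $\mathcal{M}^{-\frac12}=(\mathcal{M}^{\frac12})^{-1}$. $\mathrm{vec}_t(\mathcal{A})\in\mathbb{K}_l^{mn}$ stacks vertically the lateral slices $\mathcal{A}_{(:,1,:)},\dots,\mathcal{A}_{(:,n,:)}$. $\mathcal{A}\otimes_t\mathcal{B}$ is the block tubal matrix with $(i,j)$ block $\mathcal{A}_{(i,j,:)}*\mathcal{B}$ (the tube $\mathcal{A}_{(i,j,:)}\in\mathbb{K}_l^{1\times1}$ t-multiplied with every tube of $\mathcal{B}$). $\mathbf{Range}(\mathcal{A})=\{\mathcal{A}*\overrightarrow{\mathcal{X}}:\overrightarrow{\mathcal{X}}\in\mathbb{K}_l^{n}\}$. For T-symmetric T-positive semidefinite $\mathcal{D}$, $\|\overrightarrow{\mathcal{X}}\|_{\mathcal{D}}^2=\langle\mathcal{D}*\overrightarrow{\mathcal{X}},\overrightarrow{\mathcal{X}}\rangle$; for T-symmetric T-positive semidefinite $\mathcal{P},\mathcal{Q}$, $\|\mathcal{X}\|_{F(\mathcal{P},\mathcal{Q})}=\|\mathrm{vec}_t(\mathcal{X})\|_{\mathcal{Q}^{ST}\otimes_t\mathcal{P}}$.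 $\Delta_q$ is the set of probability vectors in $\mathbb{R}^q$; $i\sim\mathbf{p}$ means $i$ is drawn with probability $p_i$. For $i\in\{1,\dots,q_{\mathcal{S}}\}$, $j\in\{1,\dots,q_{\mathcal{V}}\}$: $\mathcal{E}_i=\mathcal{S}_i*(\mathcal{S}_i^{T}*\mathcal{A}*\mathcal{M}^{-1}*\mathcal{A}^{T}*\mathcal{S}_i)^{\dag}*\mathcal{S}_i^{T}$, $\mathcal{G}_j=\mathcal{V}_j*(\mathcal{V}_j^{T}*\mathcal{B}^{T}*\mathcal{N}^{-1}*\mathcal{B}*\mathcal{V}_j)^{\dag}*\mathcal{V}_j^{T}$, $\mathcal{Z}_i=\mathcal{M}^{-\frac12}*\mathcal{A}^{T}*\mathcal{E}_i*\mathcal{A}*\mathcal{M}^{-\frac12}$, $\mathcal{W}_j=\mathcal{N}^{-\frac12}*\mathcal{B}*\mathcal{G}_j*\mathcal{B}^{T}*\mathcal{N}^{-\frac12}$. Variance with respect to the uniform distributions: for numbers $v_{i,j}$, $\mathbf{Var}_{i\sim\mathbf{u}_{\mathcal{S}},j\sim\mathbf{u}_{\mathcal{V}}}[v_{i,j}]=\frac{1}{q_{\mathcal{S}}q_{\mathcal{V}}}\sum_{i=1}^{q_{\mathcal{S}}}\sum_{j=1}^{q_{\mathcal{V}}}\Big(v_{i,j}-\frac{1}{q_{\mathcal{S}}q_{\mathcal{V}}}\sum_{a=1}^{q_{\mathcal{S}}}\sum_{b=1}^{q_{\mathcal{V}}}v_{a,b}\Big)^2$.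
   Formalization: The solution X* is also assumed to satisfy vec_t(X* ) in R; in the ''Furthermore'' bound both sides are conditioned on X^1 (or both on X^0), and the random product of the rho_d is replaced by any constant c >= 0 that bounds it almost surely. *)

(* Defs.v *)
From HB Require Import structures.
From mathcomp Require Import all_boot all_order all_algebra.
From mathcomp Require Import all_classical all_reals all_analysis.

Set Implicit Arguments.
Unset Strict Implicit.
Unset Printing Implicit Defensive.

Import Order.TTheory GRing.Theory Num.Theory.
Local Open Scope classical_set_scope.
Local Open Scope ring_scope.

(* An m x n tubal matrix with l.+1 >= 1 frontal slices.  Slices are indexed
   from 0, and ['I_l.+1] carries its cyclic group structure: the 1-based slice
   ((p - q) mod (l+1)) + 1 is [A (p - q)], and the 1-based slice "number of
   slices - k + 2" (k >= 2) is [A (- k)], with - 0 = 0 for the first slice.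
   Addition, subtraction and scaling are those of finite functions. *)
Notation tubal R l m n := {ffun 'I_l.+1 -> 'M[R]_(m, n)}.

Section TubalAlgebra.
Context {R : realType} {l : nat}.
Implicit Types m n p q r : nat.

Definition unfold m n (A : tubal R l m n) : 'M[R]_(\sum_(k < l.+1) m, n) :=
  \mxcol_(k < l.+1) A k.

Definition fold m n (U : 'M[R]_(\sum_(k < l.+1) m, n)) : tubal R l m n :=
  [ffun k => submxcol U k].

Definition bcirc m n (A : tubal R l m n) :
    'M[R]_(\sum_(p < l.+1) m, \sum_(q < l.+1) n) :=
  \mxblock_(p < l.+1, q < l.+1) A (p - q).

Definition tprod m r n (A : tubal R l m r) (B : tubal R l r n) : tubal R l m n :=
  fold (bcirc A *m unfold B).

Definition tid n : tubal R l n n := [ffun k => if k == 0 then 1%:M else 0].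

Definition ttr m n (A : tubal R l m n) : tubal R l n m :=
  [ffun k => (A (- k))^T].

Definition tst m n (A : tubal R l m n) : tubal R l n m := [ffun k => (A k)^T].

Definition trev m n (A : tubal R l m n) : tubal R l m n := [ffun k => A (- k)].

Definition is_tinv n (A X : tubal R l n n) : Prop :=
  tprod A X = tid n /\ tprod X A = tid n.

Definition tinv n (A : tubal R l n n) : tubal R l n n :=
  xget 0 [set X | is_tinv A X].

Definition is_tpinv m n (A : tubal R l m n) (X : tubal R l n m) : Prop :=
  [/\ tprod (tprod A X) A = A,
      tprod (tprod X A) X = X,
      ttr (tprod A X) = tprod A X &
      ttr (tprod X A) = tprod X A].

Definition tpinv m n (A : tubal R l m n) : tubal R l n m :=
  xget 0 [set X | is_tpinv A X].

Definition tinner m n (A B : tubal R l m n) : R :=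
  \sum_k \sum_i \sum_j A k i j * B k i j.

Definition tsym n (M : tubal R l n n) : Prop := M = ttr M.

Definition tposdef n (M : tubal R l n n) : Prop :=
  tsym M /\ forall X : tubal R l n 1, X != 0 -> 0 < tinner X (tprod M X).

(* The symmetric positive semidefinite square root of a real matrix. *)
Definition is_msqrt n (A H : 'M[R]_n) : Prop :=
  [/\ H^T = H,
      forall x : 'cV[R]_n, 0 <= (x^T *m H *m x) 0 0 &
      H *m H = A].

Definition msqrt n (A : 'M[R]_n) : 'M[R]_n := xget 0 [set H | is_msqrt A H].

Definition tsqrt n (M : tubal R l n n) : tubal R l n n :=
  xget 0 [set H | bcirc H = msqrt (bcirc M)].

Definition vect m n (A : tubal R l m n) : tubal R l (\sum_(j < n) m) 1 :=
  [ffun k => \mxcol_(j < n) col j (A k)].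

Definition tube m n (A : tubal R l m n) (i : 'I_m) (j : 'I_n) : tubal R l 1 1 :=
  [ffun k => (A k i j)%:M].

Definition tube_mul m n (a : tubal R l 1 1) (B : tubal R l m n) :
    tubal R l m n :=
  [ffun k => \matrix_(i, j) tprod a (tube B i j) k 0 0].

Definition tkron m n p q (A : tubal R l m n) (B : tubal R l p q) :
    tubal R l (\sum_(i < m) p) (\sum_(j < n) q) :=
  [ffun k => \mxblock_(i < m, j < n) tube_mul (tube A i j) B k].

Definition trange m n (A : tubal R l m n) : set (tubal R l m 1) :=
  [set Y | exists X : tubal R l n 1, Y = tprod A X].

(* Squared norms, for T-symmetric T-positive semidefinite weights. *)
Definition normsqD n (D : tubal R l n n) (X : tubal R l n 1) : R :=
  tinner (tprod D X) X.

Definition normsqF m n (P : tubal R l m m) (Q : tubal R l n n)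
    (X : tubal R l m n) : R :=
  normsqD (tkron (tst Q) P) (vect X).

End TubalAlgebra.

Section SketchAndProject.
Context {R : realType} {l m n r s tau zeta qS qV : nat}.
Variables (A : tubal R l m r) (B : tubal R l s n) (C : tubal R l m n).
Variables (M : tubal R l r r) (N : tubal R l s s).
Variables (S : 'I_qS -> tubal R l m tau) (V : 'I_qV -> tubal R l n zeta).

Local Notation "X ** Y" := (tprod X Y) (at level 40, left associativity).

Definition Emx (i : 'I_qS) : tubal R l m m :=
  S i ** tpinv (ttr (S i) ** A ** tinv M ** ttr A ** S i) ** ttr (S i).

Definition Gmx (j : 'I_qV) : tubal R l n n :=
  V j ** tpinv (ttr (V j) ** ttr B ** tinv N ** B ** V j) ** ttr (V j).

Definition Zmx (i : 'I_qS) : tubal R l r r :=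
  tinv (tsqrt M) ** ttr A ** Emx i ** A ** tinv (tsqrt M).

Definition Wmx (j : 'I_qV) : tubal R l s s :=
  tinv (tsqrt N) ** B ** Gmx j ** ttr B ** tinv (tsqrt N).

Definition sketch_range : set (tubal R l (\sum_(j < s) r) 1) :=
  trange (tkron (tst (tinv N) ** trev B) (tinv M ** ttr A)).

Definition sketch_loss (X : tubal R l r s) (ij : 'I_qS * 'I_qV) : R :=
  normsqF (Emx ij.1) (Gmx ij.2) (A ** X ** B - C).

Definition total_loss (X : tubal R l r s) : R :=
  \sum_i \sum_j sketch_loss X (i, j).

Definition pr_prob (X : tubal R l r s) (ij : 'I_qS * 'I_qV) : R :=
  sketch_loss X ij / total_loss X.

Definition sketch_step (X : tubal R l r s) (ij : 'I_qS * 'I_qV) :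
    tubal R l r s :=
  X - tinv M ** ttr A ** Emx ij.1 ** (A ** X ** B - C)
        ** Gmx ij.2 ** ttr B ** tinv N.

Definition unif_mean q (T : lmodType R) (F : 'I_q -> T) : T :=
  q%:R^-1 *: \sum_i F i.

Definition unif_var (v : 'I_qS * 'I_qV -> R) : R :=
  (qS%:R * qV%:R)^-1 *
    \sum_i \sum_j (v (i, j) -
      (qS%:R * qV%:R)^-1 * \sum_a \sum_b v (a, b)) ^+ 2.

Definition rate_ratio (Y : tubal R l (\sum_(j < s) r) 1) : R :=
  normsqD (tkron (unif_mean (fun j => tst (Wmx j))) (unif_mean Zmx))
          (tkron (tst (tsqrt N)) (tsqrt M) ** Y)
  / normsqD (tkron (tst N) M) Y.

Definition is_delta2 (delta2 : R) : Prop :=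
  let ratios := [set rate_ratio Y | Y in [set Y | sketch_range Y /\ Y != 0]] in
  ratios delta2 /\ lbound ratios delta2.

Definition rho_pr (delta2 : R) (X : tubal R l r s) : R :=
  1 - (1 + qS%:R ^+ 2 * qV%:R ^+ 2 * unif_var (pr_prob X)) * delta2.

Definition zero_loss (X : tubal R l r s) : {set 'I_qS * 'I_qV} :=
  [set ij | sketch_loss X ij == 0]%SET.

Definition rho_zero (delta2 : R) (X : tubal R l r s) : R :=
  1 - (1 + #|zero_loss X|%:R / (qS%:R * qV%:R)) * delta2.

(* [ij t w] is the index pair drawn at step t.  The last clause is the
   conditional law of the draw at step t given the draws of the steps before t:
   the history is that of an arbitrary sample point w0, and it determines
   [X t].  If the total loss vanishes then so does every sketched residual, and
   the update leaves the iterate unchanged whatever pair is drawn; the sampling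
   probabilities are then 0/0 and the draw is left unconstrained. *)
Definition atesp_pr d (Omega : measurableType d) (P : probability Omega R)
    (X0 : tubal R l r s) (ij : nat -> Omega -> 'I_qS * 'I_qV)
    (X : nat -> Omega -> tubal R l r s) : Prop :=
  [/\ forall t a, measurable [set w | ij t w = a],
      forall w, X 0%N w = X0,
      forall t w, X t.+1 w = sketch_step (X t w) (ij t w) &
      forall t (w0 : Omega) (a : 'I_qS * 'I_qV),
        let past := [set w | forall u, (u < t)%N -> ij u w = ij u w0] in
        total_loss (X t w0) != 0 ->
        P (past `&` [set w | ij t w = a]) =
          ((pr_prob (X t w0) a)%:E * P past)%E].

End SketchAndProject.

(* Elementary conditional expectation given an event of nonzero probability.
   Every iterate takes finitely many values, so the values of
   E[Y | X^t = x] over the x with P[X^t = x] != 0 determine E[Y | X^t]. *)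
Definition condE d (Omega : measurableType d) (R : realType)
    (P : probability Omega R) (Y : Omega -> R) (E : set Omega) : R :=
  fine (\int[P]_(w in E) (Y w)%:E)%E / fine (P E).

(* Main.v *)
Require Import Defs.
From mathcomp Require Import all_boot all_order all_algebra.
From mathcomp Require Import all_classical all_reals all_analysis.
From mathcomp Require Import measurable_realfun ring lra.

(* With e = X - X* and K = A * M^-1 * A^T, the sketching tensors satisfy
   E_i * K * E_i = E_i (likewise for G_j), so one step along (i, j) decreases
   ||e||^2 by exactly the sketched loss f_ij.  Sampling proportionally to f_ij
   turns the mean decrease sum f^2 / sum f into (1 + q^2 Var p) times the uniform
   mean of f, which is at least delta^2 ||e||^2 because every error stays in the
   range; as p vanishes on Omega_d, q^2 Var p >= |Omega_d| / q.  The product bound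
   follows by recursion along the tree of draws, dividing the bound by one factor
   at a time. *)

Set Implicit Arguments.
Unset Strict Implicit.
Unset Printing Implicit Defensive.
Import Order.TTheory GRing.Theory Num.Theory.
Local Open Scope classical_set_scope.
Local Open Scope ring_scope.

(** The weights of the norms are Kronecker products, but [tkron (tst Q) P] acts on [vect X] as
    [P ** X ** Q]. Every squared norm thus becomes [tinner (P ** X ** Q) X], and factors cross
    [tinner] by [ttr]; one step is then pure algebra in [**], without a Fourier transform along the
    slices. This algebra does not give the sign of [normsqF M N X], since definiteness of [M] and
    [N] is stated on single lateral slices while the norm couples both. Writing a multiple of [N] as
    a sum of terms [w ** ttr w] reduces it to the quadratic form of [M] at the slices [X ** w]. In
    the product bound each factor depends on the iterate, so it cannot be pulled out of an
    expectation. It is however constant once the earlier draws are fixed, which is why the recursion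
    runs over histories and carries the bound [c] as a parameter. *)

Local Notation "X ** Y" := (tprod X Y) (at level 40, left associativity).

(** * Tubal algebra *)

Section TubalAlgebra.
Context {R : realType} {l : nat}.
Implicit Types (m n p q r : nat) (a : R).

Lemma tprodE m r n (A : tubal R l m r) (B : tubal R l r n) k :
  (A ** B) k = \sum_p A (k - p) *m B p.
Proof.
by rewrite /tprod /fold ffunE /bcirc mxblockEv mxcol_mul mxcolK mul_mxrow_mxcol.
Qed.

Lemma tprodA m n p q (A : tubal R l m n) (B : tubal R l n p)
  (C : tubal R l p q) : A ** (B ** C) = A ** B ** C.
Proof.
apply/ffunP => k; rewrite !tprodE.
under eq_bigr do rewrite tprodE mulmx_sumr.
under [RHS]eq_bigr do rewrite tprodE mulmx_suml.
rewrite exchange_big; apply: eq_bigr => j _.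
rewrite (reindex_inj (addIr j)); apply: eq_bigr => i _.
by rewrite addrK mulmxA opprD addrAC addrA.
Qed.

Lemma tprod1l m n (A : tubal R l m n) : tid m ** A = A.
Proof.
apply/ffunP => k; rewrite tprodE (bigD1 k) //= big1 => [|i ik].
  by rewrite ffunE subrr eqxx mul1mx addr0.
by rewrite ffunE subr_eq0 eq_sym (negPf ik) mul0mx.
Qed.

Lemma tprod1r m n (A : tubal R l m n) : A ** tid n = A.
Proof.
apply/ffunP => k; rewrite tprodE (bigD1 0) //= big1 => [|i ik].
  by rewrite ffunE eqxx mulmx1 addr0 subr0.
by rewrite ffunE (negPf ik) mulmx0.
Qed.

Lemma tprodDl m n p (A B : tubal R l m n) (C : tubal R l n p) :
  (A + B) ** C = A ** C + B ** C.
Proof.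
apply/ffunP => k; rewrite tprodE [RHS]ffunE !tprodE -big_split.
apply: eq_bigr => i _.
by rewrite ffunE mulmxDl.
Qed.

Lemma tprodDr m n p (A : tubal R l m n) (B C : tubal R l n p) :
  A ** (B + C) = A ** B + A ** C.
Proof.
apply/ffunP => k; rewrite tprodE [RHS]ffunE !tprodE -big_split.
apply: eq_bigr => i _.
by rewrite ffunE mulmxDr.
Qed.

Lemma tprodZl m n p a (A : tubal R l m n) (B : tubal R l n p) :
  (a *: A) ** B = a *: (A ** B).
Proof.
apply/ffunP => k; rewrite tprodE [RHS]ffunE !tprodE scaler_sumr.
apply: eq_bigr => i _.
by rewrite ffunE scalemxAl.
Qed.

Lemma tprodZr m n p a (A : tubal R l m n) (B : tubal R l n p) :
  A ** (a *: B) = a *: (A ** B).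
Proof.
apply/ffunP => k; rewrite tprodE [RHS]ffunE !tprodE scaler_sumr.
apply: eq_bigr => i _.
by rewrite ffunE scalemxAr.
Qed.

Lemma tprod0l m n p (A : tubal R l n p) : (0 : tubal R l m n) ** A = 0.
Proof. by rewrite -(scale0r 0) tprodZl scale0r. Qed.

Lemma tprod0r m n p (A : tubal R l m n) : A ** (0 : tubal R l n p) = 0.
Proof. by rewrite -(scale0r 0) tprodZr scale0r. Qed.

Lemma tprodBl m n p (A B : tubal R l m n) (C : tubal R l n p) :
  (A - B) ** C = A ** C - B ** C.
Proof. by rewrite -scaleN1r tprodDl tprodZl scaleN1r. Qed.

Lemma tprodBr m n p (A : tubal R l m n) (B C : tubal R l n p) :
  A ** (B - C) = A ** B - A ** C.
Proof. by rewrite -scaleN1r tprodDr tprodZr scaleN1r. Qed.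

Lemma tprod_suml I (s : seq I) (P : pred I) m n p
    (F : I -> tubal R l m n) (A : tubal R l n p) :
  (\sum_(i <- s | P i) F i) ** A = \sum_(i <- s | P i) F i ** A.
Proof.
exact: (big_morph (fun X => X ** A) (fun _ _ => tprodDl _ _ _) (tprod0l _ _)).
Qed.

Lemma tprod_sumr I (s : seq I) (P : pred I) m n p
    (F : I -> tubal R l n p) (A : tubal R l m n) :
  A ** (\sum_(i <- s | P i) F i) = \sum_(i <- s | P i) A ** F i.
Proof. exact: (big_morph (tprod A) (tprodDr A) (tprod0r _ _)). Qed.

Lemma ttrK m n (A : tubal R l m n) : ttr (ttr A) = A.
Proof. by apply/ffunP => k; rewrite !ffunE opprK trmxK. Qed.

Lemma ttr_tprod m n p (A : tubal R l m n) (B : tubal R l n p) :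
  ttr (A ** B) = ttr B ** ttr A.
Proof.
apply/ffunP => k; rewrite [LHS]ffunE tprodE [RHS]tprodE raddf_sum /=.
rewrite (reindex_inj (addIr (- k))); apply: eq_bigr => i _.
by rewrite trmx_mul !ffunE !opprB addrA addNr add0r.
Qed.

Lemma tst_tprod m n p (A : tubal R l m n) (B : tubal R l n p) :
  tst (A ** B) = tst B ** tst A.
Proof.
apply/ffunP => k; rewrite [LHS]ffunE tprodE [RHS]tprodE raddf_sum /=.
rewrite (reindex_inj (subrI k)); apply: eq_bigr => i _.
by rewrite trmx_mul !ffunE subKr.
Qed.

Lemma tst_ttr m n (A : tubal R l m n) : tst (ttr A) = trev A.
Proof. by apply/ffunP => k; rewrite !ffunE trmxK. Qed.

Lemma tinnerC m n (A B : tubal R l m n) : tinner A B = tinner B A.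
Proof.
by do 3 (apply: eq_bigr => ? _); rewrite mulrC.
Qed.

Lemma tinnerDl m n (A B C : tubal R l m n) :
  tinner (A + B) C = tinner A C + tinner B C.
Proof.
rewrite -big_split; apply: eq_bigr => k _ /=.
rewrite -big_split; apply: eq_bigr => i _ /=.
rewrite -big_split; apply: eq_bigr => j _ /=.
by rewrite ffunE mxE mulrDl.
Qed.

Lemma tinnerZl m n a (A B : tubal R l m n) :
  tinner (a *: A) B = a * tinner A B.
Proof.
rewrite mulr_sumr; apply: eq_bigr => k _ /=.
rewrite mulr_sumr; apply: eq_bigr => i _ /=.
rewrite mulr_sumr; apply: eq_bigr => j _ /=.
by rewrite ffunE mxE mulrA.
Qed.

Lemma tinner0l m n (A : tubal R l m n) : tinner 0 A = 0.
Proof. by rewrite -(scale0r 0) tinnerZl mul0r. Qed.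

Lemma tinnerBl m n (A B C : tubal R l m n) :
  tinner (A - B) C = tinner A C - tinner B C.
Proof. by rewrite -scaleN1r tinnerDl tinnerZl mulN1r. Qed.

Lemma tinnerBr m n (A B C : tubal R l m n) :
  tinner C (A - B) = tinner C A - tinner C B.
Proof. by rewrite !(tinnerC C) tinnerBl. Qed.

Lemma tinner_suml I (s : seq I) (P : pred I) m n
    (F : I -> tubal R l m n) (A : tubal R l m n) :
  tinner (\sum_(i <- s | P i) F i) A = \sum_(i <- s | P i) tinner (F i) A.
Proof.
exact: (big_morph (fun X => tinner X A) (fun _ _ => tinnerDl _ _ _) (tinner0l _)).
Qed.

Lemma tinner_tr m n (A B : tubal R l m n) :
  tinner A B = \sum_k \tr ((A k)^T *m B k).
Proof.
apply: eq_bigr => k _; rewrite exchange_big; apply: eq_bigr => j _.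
by rewrite mxE; apply: eq_bigr => i _; rewrite mxE.
Qed.

Lemma tinner_ttr m n (A B : tubal R l m n) :
  tinner (ttr A) (ttr B) = tinner A B.
Proof.
rewrite /tinner (reindex_inj oppr_inj); apply: eq_bigr => k _.
rewrite exchange_big; apply: eq_bigr => i _; apply: eq_bigr => j _.
by rewrite !ffunE !mxE opprK.
Qed.

Lemma tinner_tprodl m n p (A : tubal R l m n) (B : tubal R l n p) C :
  tinner (A ** B) C = tinner B (ttr A ** C).
Proof.
rewrite !tinner_tr.
under eq_bigr do rewrite tprodE raddf_sum /= mulmx_suml raddf_sum.
rewrite exchange_big; apply: eq_bigr => i _.
rewrite tprodE mulmx_sumr raddf_sum; apply: eq_bigr => k _.
by rewrite ffunE opprB trmx_mul mulmxA.
Qed.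

Lemma tinner_tprodr m n p (A : tubal R l m n) (B : tubal R l n p) C :
  tinner (A ** B) C = tinner A (C ** ttr B).
Proof.
by rewrite -tinner_ttr ttr_tprod tinner_tprodl -tinner_ttr !ttr_tprod !ttrK.
Qed.

Lemma bcirc_tprod m n p (A : tubal R l m n) (B : tubal R l n p) :
  bcirc (A ** B) = bcirc A *m bcirc B.
Proof.
rewrite mul_mxblock; apply: eq_mxblock => i j.
rewrite tprodE (reindex_inj (addIr (- j))); apply: eq_bigr => k _.
by rewrite opprB addrA subrK.
Qed.

Lemma bcirc_inj m n : injective (@bcirc R l m n).
Proof.
move=> A B AB; apply/ffunP => k.
have := congr1 (fun X => submxblock X k 0) AB.
by rewrite !mxblockK subr0.
Qed.

Lemma bcirc_ttr m n (A : tubal R l m n) : bcirc (ttr A) = (bcirc A)^T.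
Proof.
by rewrite tr_mxblock; apply: eq_mxblock => i j; rewrite ffunE opprB.
Qed.

Lemma tinner_vect m n (A B : tubal R l m n) :
  tinner (vect A) (vect B) = tinner A B.
Proof.
rewrite !tinner_tr; apply: eq_bigr => k _.
rewrite !ffunE tr_mxcol mul_mxrow_mxcol raddf_sum; apply: eq_bigr => j _.
by rewrite /= trace_mx11 !mxE; apply: eq_bigr => i _; rewrite !mxE.
Qed.

(** The tubal form of [vec (P X Q) = (Q^T (x) P) vec X]. The slice transpose is the right one
    because tubes multiply by cyclic convolution, which is commutative, so the tubes of [Q] are
    moved to the left without reversal. *)
Lemma vect_tprod m n p q (P : tubal R l m n) (X : tubal R l n p)
    (Q : tubal R l p q) :
  tkron (tst Q) P ** vect X = vect (P ** X ** Q).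
Proof.
apply/ffunP => k; rewrite tprodE [RHS]ffunE.
apply/mxcolP => j; rewrite mxcolK submxcol_sum.
under eq_bigr => a _.
  rewrite [vect X a]ffunE [tkron _ _ _]ffunE mxblockEv mxcol_mul mxcolK.
  rewrite mul_mxrow_mxcol.
  over.
apply/matrixP => i z; rewrite ord1 {z} summxE [RHS]mxE tprodE summxE.
transitivity (\sum_a \sum_b \sum_x \sum_c
  Q c b j * P (k - a - c) i x * X a x b).
  apply: eq_bigr => a _; rewrite summxE; apply: eq_bigr => b _.
  rewrite mxE; apply: eq_bigr => x _; rewrite ffunE !mxE tprodE summxE mulr_suml.
  rewrite (reindex_inj (subrI (k - a))); apply: eq_bigr => c _.
  by rewrite !mxE big_ord1 !ffunE !mxE subKr.
transitivity (\sum_c \sum_b \sum_a \sum_x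
  Q c b j * P (k - a - c) i x * X a x b); last first.
  apply: eq_bigr => c _; rewrite mxE; apply: eq_bigr => b _.
  rewrite tprodE summxE mulr_suml; apply: eq_bigr => a _.
  rewrite mxE mulr_suml; apply: eq_bigr => x _.
  by rewrite [k - c - a]addrAC [RHS]mulrC mulrA.
under eq_bigr => a _ do under eq_bigr => b _ do rewrite exchange_big.
under [RHS]eq_bigr => c _ do rewrite exchange_big.
rewrite [RHS]exchange_big; apply: eq_bigr => a _.
by rewrite exchange_big.
Qed.

Lemma normsqFE m n (P : tubal R l m m) (Q : tubal R l n n) X :
  normsqF P Q X = tinner (P ** X ** Q) X.
Proof. by rewrite /normsqF /normsqD vect_tprod tinner_vect. Qed.

Lemma vect_inj m n : injective (@vect R l m n).
Proof.
move=> A B AB; apply/ffunP => k; apply/matrixP => i j.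
have := congr1 (fun X : tubal _ _ _ _ => submxcol (X k) j i 0) AB.
by rewrite !ffunE !mxcolK !mxE.
Qed.

Lemma vect0 m n : vect (0 : tubal R l m n) = 0.
Proof.
apply/ffunP => k; rewrite !ffunE -(mxcol0 (p_ := fun=> m)).
by apply: eq_mxcol => j; apply/matrixP => x y; rewrite !mxE.
Qed.

Lemma vect_surj m n (Y : tubal R l (\sum_(j < n) m) 1) :
  exists X : tubal R l m n, Y = vect X.
Proof.
exists [ffun k => \matrix_(i, j) submxcol (Y k) j i 0].
apply/ffunP => k; rewrite ffunE -[LHS]submxcolK; apply: eq_mxcol => j.
by apply/matrixP => x y; rewrite ord1 !(mxE, ffunE).
Qed.

End TubalAlgebra.

(** * Positivity of the weighted norm *)

Section Positivity.
Context {R : realType} {l : nat}.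

(** Symmetric elimination: subtracting [a^-1 *: (v *m v^T)], with [v] the column of a nonzero pivot
    [a], leaves a Schur complement [K'] that is again semidefinite. The pivot entry vanishes, and
    zero diagonal entries stay zero since they can only decrease yet remain nonnegative; so the
    count of nonzero diagonal entries drops. *)
Lemma psd_sum_rank1 n (K : 'M[R]_n) : K^T = K ->
  (forall c : 'cV[R]_n, 0 <= (c^T *m K *m c) 0 0) ->
  exists s : seq 'cV[R]_n, K = \sum_(w <- s) w *m w^T.
Proof.
have [k] := ubnP #|[set i | K i i != 0]%SET|.
elim: k K => // k IHk K; rewrite ltnS => Kk sK pK.
have Ke i j :
    ((delta_mx i 0 : 'cV[R]_n)^T *m K *m (delta_mx j 0 : 'cV[R]_n)) 0 0 = K i j.
  by rewrite trmx_delta -rowE -colE !mxE.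
have trB a (x y : 'cV[R]_n) : (x - a *: y)^T = x^T - a *: y^T.
  by rewrite linearB linearZ.
have Kii i : 0 <= K i i by rewrite -Ke.
have [/existsP[i Ki]|/existsPn K0] := boolP [exists i, K i i != 0]; last first.
  exists [::]; rewrite big_nil; apply/matrixP => i j; rewrite mxE.
  have {}K0 m : K m m = 0 by apply/eqP; have := K0 m; rewrite negbK.
  (* With a zero diagonal, the form at this vector is [- 2 * K i j ^+ 2], which forces
     [K i j = 0]. *)
  pose c : 'cV[R]_n := delta_mx i 0 - K i j *: (delta_mx j 0 : 'cV[R]_n).
  have := pK c; rewrite /c trB mulmxBl mulmxBl !mulmxBr.
  rewrite -!scalemxAl -!scalemxAr.
  have E (a b x y : 'M[R]_1) :
    (a - b - (x - y)) 0 0 = a 0 0 - b 0 0 - (x 0 0 - y 0 0).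
    by rewrite !mxE.
  have Z t (a : 'M[R]_1) : (t *: a) 0 0 = t * a 0 0 by rewrite mxE.
  rewrite E !Z !Ke !K0 -[in K j i]sK [K^T _ _]mxE.
  by move=> /= h; apply/eqP; rewrite -sqrf_eq0; apply/eqP; nra.
set a := K i i in Ki.
have a0 : 0 < a by rewrite lt_neqAle eq_sym Ki Kii.
pose e : 'cV[R]_n := delta_mx i 0; pose v := K *m e.
have vE j : v j 0 = K j i by rewrite /v -colE mxE.
pose K' := K - a^-1 *: (v *m v^T).
have K'E p q : K' p q = K p q - a^-1 * (K p i * K q i).
  by rewrite !mxE big_ord1 [in v^T _ _]mxE !vE.
have sK' : K'^T = K'.
  rewrite linearB linearZ /= sK trmx_mul trmxK //.
have pK' (c : 'cV[R]_n) : 0 <= (c^T *m K' *m c) 0 0.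
  pose b := (v^T *m c) 0 0.
  have vc : v^T *m c = b%:M by rewrite [LHS]mx11_scalar.
  have cv : c^T *m v = b%:M by rewrite -[LHS]trmxK trmx_mul trmxK vc tr_scalar_mx.
  have vK : e^T *m K = v^T by rewrite /v trmx_mul sK.
  have ve : v^T *m e = a%:M by rewrite [LHS]mx11_scalar -vK Ke.
  (* Completing the square: [b / a] minimizes the form of [K] along [c - t *: e], and the minimum is
     the form of [K'] at [c]. *)
  suff -> : c^T *m K' *m c =
      (c - (b / a) *: e)^T *m K *m (c - (b / a) *: e) by exact: pK.
  have -> : c^T *m K' *m c = c^T *m K *m c - a^-1 *: (b%:M *m b%:M).
    rewrite /K' mulmxBr mulmxBl -scalemxAr mulmxA cv -scalemxAl.
    by rewrite -(mulmxA b%:M) vc.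
  rewrite trB mulmxBl mulmxBl !mulmxBr -!scalemxAl -!scalemxAr.
  rewrite vK vc ve -[c^T *m K *m e]mulmxA -/v cv.
  apply/matrixP => ? ?; rewrite !ord1 !mxE !eqxx !mulr1n big_ord1 !mxE !eqxx.
  by rewrite !mulr1n; field.
have lt_k : (#|[set j | K' j j != 0%R]%SET| < k)%N.
  apply: leq_trans Kk; apply: proper_card; apply/properP; split; last first.
    exists i; first by rewrite inE.
    by rewrite inE K'E -/a mulKf// subrr eqxx.
  apply/fintype.subsetP => j; rewrite !inE; apply: contraNneq => Kj.
  apply/eqP/le_anti/andP; split; last first.
    rewrite -[K' j j]mulr1; have := pK' (delta_mx j 0).
    by rewrite trmx_delta -rowE -colE !mxE mulr1.
  by rewrite K'E Kj sub0r oppr_le0 -expr2 mulr_ge0 ?sqr_ge0 // invr_ge0 ltW.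
have [s sE] := IHk _ lt_k sK' pK'.
exists ((Num.sqrt a)^-1 *: v :: s).
rewrite big_cons -sE /K' linearZ /= -scalemxAl -scalemxAr scalerA -expr2.
by rewrite exprVn sqr_sqrtr ?(ltW a0)// addrC subrK.
Qed.

Lemma tinner_unfold n (X Y : tubal R l n 1) :
  tinner X Y = ((unfold X)^T *m unfold Y) 0 0.
Proof.
rewrite tinner_tr tr_mxcol mul_mxrow_mxcol summxE; apply: eq_bigr => k _.
by rewrite trace_mx11.
Qed.

Lemma foldK m n (U : 'M[R]_(\sum_(k < l.+1) m, n)) : unfold (fold U) = U.
Proof.
by rewrite -[RHS]submxcolK; apply: eq_mxcol => k; rewrite ffunE.
Qed.

(** The vectors come from a rank-one decomposition of [bcirc N], folded back. Slice [k] of [N] fills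
    the [l.+1] blocks [(k - p, - p)] of [bcirc N]; the same blocks of [w *m w^T] add up to slice [k]
    of [fold w ** ttr (fold w)], whence the factor [l.+1]. *)
Lemma tposdef_sum_rank1 n (N : tubal R l n n) : tposdef N ->
  exists s : seq (tubal R l n 1), l.+1%:R *: N = \sum_(w <- s) w ** ttr w.
Proof.
move=> [sN pN].
have [||s sE] := @psd_sum_rank1 _ (bcirc N).
- by rewrite -bcirc_ttr -sN.
- move=> c; rewrite -(foldK c) -mulmxA.
  have -> : bcirc N *m unfold (fold c) = unfold (N ** fold c).
    by rewrite /tprod !foldK.
  rewrite -tinner_unfold; have [->|c0] := eqVneq (fold c) 0.
    by rewrite tinner0l.
  exact/ltW/pN.
exists [seq fold w | w <- s]; rewrite big_map; apply/ffunP => k.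
rewrite ffunE sum_ffunE; under [RHS]eq_bigr do rewrite tprodE.
rewrite exchange_big /=.
transitivity (\sum_(p < l.+1) N k).
  by rewrite sumr_const card_ord scaler_nat.
apply: eq_bigr => p _.
have -> : N k = submxblock (bcirc N) (k - p) (- p).
  by rewrite mxblockK opprK subrK.
rewrite sE submxblockEh.
transitivity (\sum_(w <- s) submxblock (w *m w^T) (k - p) (- p)).
  rewrite -submxblockEh.
  apply: (big_morph (fun X => submxblock X (k - p) (- p))).
    by move=> ? ?; rewrite submxblockD.
  by rewrite submxblock0.
apply: eq_bigr => w _; rewrite !ffunE -[w in LHS]submxcolK tr_mxcol.
by rewrite mul_mxcol_mxrow mxblockK.
Qed.

Lemma normsqF_ge0 m n (M : tubal R l m m) (N : tubal R l n n) X :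
  tposdef M -> tposdef N -> 0 <= normsqF M N X.
Proof.
move=> [sM pM] /tposdef_sum_rank1[s sE].
rewrite -(@pmulr_rge0 _ l.+1%:R)// normsqFE -tinnerZl -tprodZr sE.
rewrite tprod_sumr tinner_suml; apply: sumr_ge0 => w _.
rewrite tprodA tinner_tprodr ttrK tinnerC -tprodA.
by have [->|Xw0] := eqVneq (X ** w) 0; [rewrite tinner0l | exact/ltW/pM].
Qed.

End Positivity.

(** * Inverses, Moore-Penrose inverses and square roots *)

Section Inverses.
Context {R : realType} {l : nat}.

Lemma is_tinv_unique n (A X Y : tubal R l n n) :
  is_tinv A X -> is_tinv A Y -> X = Y.
Proof.
by move=> [_ XA] [AY _]; rewrite -[X]tprod1r -AY tprodA XA tprod1l.
Qed.

Lemma tinvP n (A X : tubal R l n n) : is_tinv A X -> is_tinv A (tinv A).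
Proof. by move=> AX; apply: (@xgetPex _ 0 (fun X => is_tinv A X)); exists X. Qed.

Lemma ttr_tid n : ttr (tid n) = tid n :> tubal R l n n.
Proof.
apply/ffunP => k; rewrite !ffunE oppr_eq0.
by case: eqP; rewrite ?trmx1 ?trmx0.
Qed.

Lemma is_tinv_ttr n (A X : tubal R l n n) :
  is_tinv A X -> is_tinv (ttr A) (ttr X).
Proof. by move=> [AX XA]; split; rewrite -ttr_tprod ?AX ?XA ttr_tid. Qed.

Lemma is_tpinv_unique m n (A : tubal R l m n) X Y :
  is_tpinv A X -> is_tpinv A Y -> X = Y.
Proof.
move=> [AXA XAX sAX sXA] [AYA YAY sAY sYA].
have AXY : A ** X = A ** Y.
  by rewrite -[LHS]sAX -{1}AYA -tprodA ttr_tprod sAX sAY tprodA AXA.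
have XYA : X ** A = Y ** A.
  by rewrite -[LHS]sXA -{1}AYA -(tprodA A) tprodA ttr_tprod sXA sYA -tprodA
             (tprodA A) AXA.
by rewrite -XAX XYA -tprodA AXY tprodA YAY.
Qed.

Lemma is_tpinv_ttr m n (A : tubal R l m n) X :
  is_tpinv A X -> is_tpinv (ttr A) (ttr X).
Proof.
move=> [AXA XAX sAX sXA].
by split; rewrite -!ttr_tprod ?tprodA ?AXA ?XAX ?sAX ?sXA.
Qed.

(* If no Moore-Penrose inverse existed, [tpinv H] would be 0 and both equations
   would still hold, so its existence need not be established. *)
Lemma tpinv_sym n (H : tubal R l n n) : ttr H = H ->
  ttr (tpinv H) = tpinv H /\ tpinv H ** H ** tpinv H = tpinv H.
Proof.
move=> sH; rewrite /tpinv; case: xgetP => [X _ HX|_].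
  split; last by case: HX.
  by apply: (is_tpinv_unique _ HX); rewrite -[H]sH; exact: is_tpinv_ttr.
by rewrite !tprod0r; split => //; apply/ffunP => k; rewrite !ffunE trmx0.
Qed.

(** With [H = ttr T ** K ** T] and [X = tpinv H], the product [E ** K ** E] is
    [T ** (X ** H ** X) ** ttr T], so the Penrose equation [X ** H ** X = X] is all that is used. It
    makes [E ** K] idempotent. *)
Lemma sketch_proj m p (T : tubal R l m p) (K : tubal R l m m) :
  ttr K = K ->
  let E := T ** tpinv (ttr T ** K ** T) ** ttr T in
  ttr E = E /\ E ** K ** E = E.
Proof.
move=> sK E; rewrite /E.
have [|sX XHX] := @tpinv_sym _ (ttr T ** K ** T).
  by rewrite !ttr_tprod ttrK sK tprodA.
split; first by rewrite !ttr_tprod ttrK sX tprodA.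
by rewrite -[in RHS]XHX !tprodA.
Qed.

(** [tsqrt] and [msqrt] are both choices with default 0, and a default in either one gives
    [tsqrt M = 0] because [bcirc] is injective. Otherwise the equations of the matrix root are read
    back through [bcirc]. *)
Lemma tsqrtP n (M : tubal R l n n) :
  tsqrt M = 0 \/ ttr (tsqrt M) = tsqrt M /\ tsqrt M ** tsqrt M = M.
Proof.
rewrite /tsqrt; case: xgetP => [H _ HE|_]; last by left.
move: HE; rewrite /= /msqrt; case: xgetP => [K _ [sK _ KK] HK|_ H0].
  right; split; apply: bcirc_inj; first by rewrite bcirc_ttr HK.
  by rewrite bcirc_tprod HK.
by left; apply: bcirc_inj; rewrite H0; apply/mxblockP => i j;
  rewrite mxblockK ffunE submxblock0.
Qed.

(** [H] commutes with [M = H ** H], hence with [Mi], which makes the obvious one-sided inverse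
    two-sided. *)
Lemma is_tinv_sqrt n (M H Mi : tubal R l n n) :
  H ** H = M -> is_tinv M Mi -> is_tinv H (H ** Mi).
Proof.
move=> HH [MMi MiM]; split; first by rewrite tprodA HH.
have comm : H ** M = M ** H by rewrite -HH tprodA.
have -> : H ** Mi = Mi ** H.
  by rewrite -[H ** Mi]tprod1l -MiM -!tprodA (tprodA M) -comm -tprodA MMi tprod1r.
by rewrite -tprodA HH.
Qed.

End Inverses.

(** * One sketch-and-project step *)

Section Sketch.
Context {R : realType} {l m n r s tau zeta qS qV : nat}.
Variables (A : tubal R l m r) (B : tubal R l s n) (C : tubal R l m n).
Variables (M : tubal R l r r) (N : tubal R l s s).
Variables (S : 'I_qS -> tubal R l m tau) (V : 'I_qV -> tubal R l n zeta).
Variables (Xs : tubal R l r s) (delta2 : R).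
Hypotheses (hqS : (0 < qS)%N) (hqV : (0 < qV)%N).
Hypotheses (hM : tposdef M) (hN : tposdef N) (hXs : A ** Xs ** B = C).
Hypothesis hXsR : sketch_range A B M N (vect Xs).
Hypothesis hdelta2 : is_delta2 A B M N S V delta2.

Let in_range X := sketch_range A B M N (vect X).
Let err X := normsqF M N (X - Xs).
Let loss := sketch_loss A B C M N S V.
Let total := total_loss A B C M N S V.
Let step := sketch_step A B C M N S V.

(** Since [trev B = tst (ttr B)], the first Kronecker factor is [tst (ttr B ** tinv N)], and
    [vect_tprod] undoes the vectorization. *)
Lemma sketch_rangeE X : sketch_range A B M N (vect X) <->
  exists U, X = tinv M ** ttr A ** U ** (ttr B ** tinv N).
Proof.
rewrite /sketch_range /trange /= -tst_ttr -tst_tprod; split => [[Y]|[U ->]].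
  by have [U ->] := vect_surj Y; rewrite vect_tprod => /vect_inj ->; exists U.
by exists (vect U); rewrite vect_tprod.
Qed.

(* Without inverses [sketch_range] would be 0 and [delta2] could not exist. *)
Lemma tinv_weights : is_tinv M (tinv M) /\ is_tinv N (tinv N).
Proof.
have [[Y [YR Y0] _] _] := hdelta2; move: YR Y0.
have [X ->] := vect_surj Y; move=> /sketch_rangeE[U ->].
rewrite /tinv; case: xgetP => [Mi _ MMi|_]; case: xgetP => [Ni _ NNi|_] //;
  by rewrite ?tprod0r ?tprod0l vect0 eqxx.
Qed.

Lemma ttr_tinvM : ttr (tinv M) = tinv M.
Proof.
have [MMi _] := tinv_weights; apply: (is_tinv_unique _ MMi).
by case: hM => sM _; rewrite {1}sM; exact: is_tinv_ttr.
Qed.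

Lemma ttr_tinvN : ttr (tinv N) = tinv N.
Proof.
have [_ NNi] := tinv_weights; apply: (is_tinv_unique _ NNi).
by case: hN => sN _; rewrite {1}sN; exact: is_tinv_ttr.
Qed.

Lemma EmxP i : let E := Emx A M S i in
  ttr E = E /\ E ** (A ** tinv M ** ttr A) ** E = E.
Proof.
have := @sketch_proj _ _ _ _ (S i) (A ** tinv M ** ttr A).
rewrite /= /Emx -!(tprodA (ttr (S i))) !tprodA; apply.
by rewrite !ttr_tprod ttrK ttr_tinvM tprodA.
Qed.

Lemma GmxP j : let G := Gmx B N V j in
  ttr G = G /\ G ** (ttr B ** tinv N ** B) ** G = G.
Proof.
have := @sketch_proj _ _ _ _ (V j) (ttr B ** tinv N ** B).
rewrite /= /Gmx -!(tprodA (ttr (V j))) !tprodA; apply.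
by rewrite !ttr_tprod ttrK ttr_tinvN tprodA.
Qed.

Let update x (a : 'I_qS * 'I_qV) :=
  tinv M ** ttr A ** Emx A M S a.1 ** (A ** (x - Xs) ** B) ** Gmx B N V a.2
    ** ttr B ** tinv N.

Lemma residualE x : A ** x ** B - C = A ** (x - Xs) ** B.
Proof. by rewrite tprodBr tprodBl hXs. Qed.

Lemma loss_inner x a : loss x a =
  tinner (M ** update x a ** N) (x - Xs).
Proof.
have [[MMi _] [_ NiN]] := tinv_weights.
rewrite /loss /sketch_loss normsqFE residualE -(tprodA A).
rewrite tinnerC tinner_tprodl tinner_tprodr tinnerC /update.
move: (Emx A M S a.1) (Gmx B N V a.2) => E G.
by rewrite !tprodA MMi tprod1l -(tprodA _ _ N) NiN tprod1r.
Qed.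

(** Let [u] be the update and [y = A ** (x - Xs) ** B]. Then [M ** u ** N] is
    [ttr A ** (E ** y ** G) ** ttr B] and [A ** u ** B] is [K ** (E ** y ** G) ** L], so the squared
    norm pairs [E ** y ** G] with the latter; [E ** K ** E = E] and [G ** L ** G = G] collapse it to
    the loss. *)
Lemma loss_update x a : loss x a = normsqF M N (update x a).
Proof.
have [[MMi _] [_ NiN]] := tinv_weights.
have := GmxP a.2; have := EmxP a.1.
rewrite /loss /sketch_loss !normsqFE residualE /update.
move: (Emx A M S a.1) (Gmx B N V a.2) (A ** _ ** B) => E G y /=.
move=> [sE EKE] [sG GLG]; set u := _ ** tinv N.
have -> : M ** u ** N = ttr A ** (E ** y ** G) ** ttr B.
  by rewrite /u !tprodA MMi tprod1l -(tprodA _ _ N) NiN tprod1r.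
rewrite [RHS]tinner_tprodr [RHS]tinner_tprodl !ttrK.
have -> : A ** (u ** B) =
    A ** tinv M ** ttr A ** (E ** y ** G) ** (ttr B ** tinv N ** B).
  by rewrite /u !tprodA.
move: (A ** _ ** _) (ttr B ** _ ** _) EKE GLG => K L EKE GLG.
rewrite [RHS]tinner_tprodr [RHS]tinner_tprodl sE sG tinnerC.
by rewrite -[E in LHS]EKE -[G in LHS]GLG !tprodA.
Qed.

Lemma err_ge0 x : 0 <= err x.
Proof. exact: normsqF_ge0. Qed.

Lemma loss_ge0 x a : 0 <= loss x a.
Proof. by rewrite loss_update normsqF_ge0. Qed.

(** Pythagoras: the cross term of the update with the error and the squared norm of the update are
    the same number, so the update is orthogonal to the new error. *)
Lemma err_step x a : err (step x a) = err x - loss x a.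
Proof.
have -> : err (step x a) = normsqF M N (x - Xs - update x a).
  by rewrite /err /step /sketch_step residualE addrAC.
have sM : ttr M = M by case: hM => /esym.
have sN : ttr N = N by case: hN => /esym.
have := loss_update x a; have := loss_inner x a; rewrite /err !normsqFE.
move: (update x a) (x - Xs) (loss x a) => u e f fe fu.
rewrite tprodBr tprodBl tinnerBl !tinnerBr -fe -fu.
have -> : tinner (M ** e ** N) u = f.
  by rewrite fe tinner_tprodr tinner_tprodl sM sN tinnerC tprodA.
by rewrite subrr subr0.
Qed.

Lemma in_range_step x a : in_range x -> in_range (step x a).
Proof.
move=> /sketch_rangeE[U xE]; apply/sketch_rangeE.
exists (U - Emx A M S a.1 ** (A ** x ** B - C) ** Gmx B N V a.2).
rewrite /step /sketch_step.
move: (Emx A M S a.1) (Gmx B N V a.2) (A ** x ** B - C) => E G y.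
by rewrite [in LHS]xE tprodBr tprodBl !tprodA.
Qed.

Let rate_num x :=
  normsqD (tkron (unif_mean (fun j => tst (Wmx B N V j)))
                 (unif_mean (Zmx A M S)))
          (tkron (tst (tsqrt N)) (tsqrt M) ** vect (x - Xs)).

(* If [M] or [N] had no square root in the sense of [tsqrt], the default value 0
   would give [rate_num x = 0], hence [delta2 = 0], and the contraction claimed
   would reduce to the monotonicity of the error; thus the existence of square
   roots is never used. *)
Lemma rate_numE x :
  rate_num x = 0 \/ rate_num x = total x / (qS%:R * qV%:R).
Proof.
rewrite /rate_num vect_tprod.
have -> : unif_mean (fun j => tst (Wmx B N V j)) = tst (unif_mean (Wmx B N V)).
  apply/ffunP => k; rewrite !ffunE !sum_ffunE linearZ /=; congr (_ *: _).
  by rewrite raddf_sum; apply: eq_bigr => j _; rewrite ffunE.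
rewrite -/(normsqF _ _ _) normsqFE.
have [->|[sH HH]] := tsqrtP M.
  by left; rewrite !tprod0l tprod0r !tprod0l tinner0l.
have [->|[sK KK]] := tsqrtP N.
  by left; rewrite !tprod0r !tprod0l tinner0l.
right; have [MMi NNi] := tinv_weights.
have [HHi HiH] := tinvP (is_tinv_sqrt HH MMi).
have [KKi KiK] := tinvP (is_tinv_sqrt KK NNi).
rewrite /unif_mean !(tprodZl, tprodZr) !tinnerZl !tprod_suml tinner_suml.
rewrite mulrA -invfM mulrC [qV%:R * _]mulrC; congr (_ / _).
apply: eq_bigr => i _; rewrite tprod_sumr tinner_suml; apply: eq_bigr => j _.
rewrite [RHS]loss_inner /update /=.
(* The outer square roots cross the inner product. Conjugation by them turns [Zmx] into
   [ttr A ** E ** A] and [Wmx] into [B ** G ** ttr B], which is the expansion of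
   [M ** update ** N]. *)
rewrite tinnerC tinner_tprodr tinner_tprodl tinnerC sH sK; congr tinner.
rewrite /Zmx /Wmx.
case: MMi => MMi _; case: NNi => _ NiN.
move: (Emx A M S i) (Gmx B N V j) (x - Xs) => E G e.
move: (tsqrt M) (tsqrt N) (tinv (tsqrt M)) (tinv (tsqrt N)) HHi HiH KKi KiK
  => H K Hi Ki HHi HiH KKi KiK {HH KK sH sK}.
move: (tinv M) (tinv N) MMi NiN => Mi Ni MMi NiN.
rewrite !tprodA HHi MMi !tprod1l -!(tprodA _ _ H) HiH.
rewrite -(tprodA _ K) KKi -(tprodA _ Ki) KiK -(tprodA _ Ni) NiN.
by rewrite !tprod1r.
Qed.

Lemma total_ge0 x : 0 <= total x.
Proof. by apply: sumr_ge0 => i _; apply: sumr_ge0 => j _; exact: loss_ge0. Qed.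

Lemma size_gt0 : 0 < qS%:R * qV%:R :> R.
Proof. by rewrite mulr_gt0 ?ltr0n. Qed.

Lemma rate_num_ge0 x : 0 <= rate_num x.
Proof.
have [->//|->] := rate_numE x.
by rewrite divr_ge0 ?total_ge0// ltW// size_gt0.
Qed.

Lemma delta2_ge0 : 0 <= delta2.
Proof.
have [[Y [_ _] <-] _] := hdelta2; have [X ->] := vect_surj Y.
have -> : X = (X + Xs) - Xs by rewrite addrK.
by apply: divr_ge0; [exact: rate_num_ge0 | exact: err_ge0].
Qed.

(** The range is a linear subspace containing [vect Xs], so a nonzero error competes in the minimum
    defining [delta2]. In both cases of [rate_numE] the numerator is at most the mean loss. *)
Lemma delta2_err x : in_range x -> delta2 * err x * (qS%:R * qV%:R) <= total x.
Proof.
move=> xR; rewrite -ler_pdivlMr ?size_gt0//.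
suff h : delta2 * err x <= rate_num x.
  apply: le_trans h _; have [->|->//] := rate_numE x.
  by rewrite divr_ge0 ?total_ge0// ltW// size_gt0.
have [e0|e0] := eqVneq (err x) 0; first by rewrite e0 mulr0 rate_num_ge0.
rewrite -ler_pdivlMr ?lt_neqAle 1?eq_sym ?e0 ?err_ge0//.
have [_] := hdelta2; apply; exists (vect (x - Xs)) => //; split; last first.
  apply: contra_neq e0 => v0.
  by rewrite /err /normsqF /normsqD v0 tprod0r tinner0l.
have /sketch_rangeE[U ->] := xR; have /sketch_rangeE[U' ->] := hXsR.
by apply/sketch_rangeE; exists (U - U'); rewrite tprodBr tprodBl.
Qed.

(** * Variance of the sampling probabilities and contraction factors *)

Let prob := pr_prob A B C M N S V.
Let rho := rho_pr A B C M N S V delta2.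
Let rho0 := rho_zero A B C M N S V delta2.
Local Notation q := (qS%:R * qV%:R : R).

Lemma sum_pairE (F : 'I_qS * 'I_qV -> R) :
  \sum_i \sum_j F (i, j) = \sum_a F a.
Proof. by rewrite pair_bigA; apply: eq_bigr => -[]. Qed.

Lemma unif_varE (v : 'I_qS * 'I_qV -> R) : \sum_a v a = 1 ->
  qS%:R ^+ 2 * qV%:R ^+ 2 * unif_var v = q * \sum_a (v a - q^-1) ^+ 2.
Proof.
move=> v1; rewrite -exprMn expr2 -(mulrA q) /unif_var mulVKf ?gt_eqF ?size_gt0//.
rewrite (sum_pairE (fun a => (v a - q^-1 * \sum_i \sum_j v (i, j)) ^+ 2)).
by rewrite sum_pairE v1 mulr1.
Qed.

Lemma prob_sum x : total x != 0 -> \sum_a prob x a = 1.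
Proof.
move=> tx; rewrite /prob /pr_prob -mulr_suml -sum_pairE; exact: divff.
Qed.

(** As the probabilities sum to 1, expanding the squares in the variance term gives
    [q * \sum_a prob x a ^+ 2 - 1], and the 1 in [rho_pr] cancels. *)
Lemma rhoE x : total x != 0 ->
  rho x = 1 - q * (\sum_a prob x a ^+ 2) * delta2.
Proof.
move=> tx; rewrite /rho /rho_pr unif_varE ?prob_sum//; congr (1 - _ * _).
rewrite (eq_bigr (fun a => prob x a ^+ 2 - 2 * q^-1 * prob x a + q^-1 ^+ 2)).
  rewrite big_split sumrB -mulr_sumr prob_sum// sumr_const card_prod !card_ord.
  rewrite -[_ *+ (_ * _)]mulr_natl natrM /=; field.
  by rewrite !pnatr_eq0 -!lt0n hqS hqV.
by move=> a _; rewrite -/(prob x a) /=; ring.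
Qed.

Lemma mean_err_le x : in_range x -> total x != 0 ->
  \sum_a prob x a * err (step x a) <= rho x * err x.
Proof.
move=> xR tx; under eq_bigr do rewrite err_step mulrBr.
rewrite sumrB -mulr_suml prob_sum// mul1r rhoE// mulrBl mul1r lerD2l lerN2.
have -> : \sum_a prob x a * loss x a = total x * \sum_a prob x a ^+ 2.
  rewrite mulr_sumr; apply: eq_bigr => a _.
  by rewrite /prob /pr_prob -/loss -/total; field.
rewrite (_ : _ * err x = (delta2 * err x * q) * \sum_a prob x a ^+ 2).
  by rewrite ler_wpM2r ?delta2_err ?sumr_ge0// => a _; exact: sqr_ge0.
ring.
Qed.

Lemma rho_le_zero x : total x != 0 -> rho x <= rho0 x.
Proof.
move=> tx; rewrite /rho /rho_pr /rho0 /rho_zero lerD2l lerN2.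
rewrite ler_wpM2r ?delta2_ge0// lerD2l unif_varE ?prob_sum//.
rewrite ler_pdivrMr ?size_gt0//.
rewrite mulrAC -expr2; set Z := zero_loss _ _ _ _ _ _ _ _.
have q0 := size_gt0.
have -> : #|Z|%:R = q ^+ 2 * \sum_(a in Z) (prob x a - q^-1) ^+ 2.
  rewrite (eq_bigr (fun=> q^-1 ^+ 2)) => [|a].
    by rewrite sumr_const -mulr_natl; field; rewrite !pnatr_eq0 -!lt0n hqS hqV.
  by rewrite inE => /eqP a0; rewrite /prob /pr_prob a0 mul0r sub0r sqrrN.
rewrite ler_wpM2l ?sqr_ge0// [leRHS](bigID (mem Z))/= lerDl sumr_ge0// => a _.
exact: sqr_ge0.
Qed.

Lemma loss_total0 x a : total x = 0 -> loss x a = 0.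
Proof.
rewrite /total /total_loss sum_pairE => /eqP.
rewrite psumr_eq0 => [/allP/(_ a)/(_ (mem_index_enum _))/eqP//|b _].
exact: loss_ge0.
Qed.

(** At zero total loss, [delta2_err] yields [delta2 * err x <= 0], so [1 - (1 + t) * delta2] cannot
    shrink the error for any [t >= 0]; this covers the variance of the degenerate quotients 0/0 as
    well. *)
Lemma err_le_total0 x : in_range x -> total x = 0 ->
  err x <= rho x * err x /\ err x <= rho0 x * err x.
Proof.
move=> xR t0; have := delta2_err xR; rewrite t0 pmulr_lle0 ?size_gt0// => de.
have h t : 0 <= t -> err x <= (1 - (1 + t) * delta2) * err x.
  move=> t0'; rewrite mulrBl mul1r lerBrDr gerDl -mulrA.
  by rewrite mulr_ge0_le0// addr_ge0.
split; apply: h.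
  rewrite mulr_ge0 ?mulr_ge0 ?sqr_ge0// ?invr_ge0 ?mulr_ge0//.
  by apply: sumr_ge0 => i _; apply: sumr_ge0 => j _; exact: sqr_ge0.
by rewrite divr_ge0// mulr_ge0.
Qed.

End Sketch.

(** * Processes driven by finitely valued draws *)

Section AdaptedProcess.
Context {R : realType} {T : finType} {d : measure_display}.
Context {Omega : measurableType d} (P : probability Omega R).
Variable ij : nat -> Omega -> T.
Hypothesis mij : forall t a, measurable [set w | ij t w = a].

(** The atom of [w0] in the filtration of the first [t] draws. Draws being finitely valued,
    conditioning reduces to finite sums over atoms. *)
Definition past t w0 := [set w | forall u, (u < t)%N -> ij u w = ij u w0].

(** The codomain is arbitrary so that [U := Prop] covers events: an adapted set is a union of
    atoms. *)
Definition adapted t U (f : Omega -> U) := forall w w', past t w w' -> f w' = f w.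

Lemma past_refl t w : past t w w.
Proof. by []. Qed.

Lemma past_leq s t w w' : (s <= t)%N -> past t w w' -> past s w w'.
Proof. by move=> st ww' u us; apply: ww'; exact: leq_trans us st. Qed.

Lemma past_trans t w1 w2 w3 : past t w1 w2 -> past t w2 w3 -> past t w1 w3.
Proof. by move=> h12 h23 u ut; rewrite h23 ?h12. Qed.

Lemma past_sym t w w' : past t w w' -> past t w' w.
Proof. by move=> h u ut; rewrite h. Qed.

Lemma past_succ t w0 w1 : past t w0 w1 ->
  past t w0 `&` [set w | ij t w = ij t w1] = past t.+1 w1.
Proof.
move=> h01; apply/seteqP; split=> [w [h0 ha] u|w h].
  by rewrite ltnS leq_eqVlt => /predU1P[->//|ut]; rewrite h0 ?h01.
split; last exact: h.
by apply: (past_trans h01); exact: past_leq h.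
Qed.

Lemma adapted_leq s t U (f : Omega -> U) :
  (s <= t)%N -> adapted s f -> adapted t f.
Proof. by move=> st fs w w' /(past_leq st); exact: fs. Qed.

Lemma cover_draws t (D : set Omega) :
  D = \big[setU/set0]_(a : T) (D `&` [set w | ij t w = a]).
Proof.
apply/seteqP; split=> w; rewrite -bigcup_seq.
  by move=> Dw; exists (ij t w) => //=; rewrite mem_index_enum.
by move=> [a _ []].
Qed.

Lemma adapted_measurable t (D : set Omega) : adapted t D -> measurable D.
Proof.
elim: t D => [|t IHt] D aD.
  have [/nonemptyPn ->|/contrapT[w Dw]] := pselect (~ (D !=set0)).
    exact: measurable0.
  by rewrite (_ : D = setT)//; apply/seteqP; split=> // w' _; rewrite (aD w).
rewrite (cover_draws t D); apply: bigsetU_measurable => a _.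
(* The union of the atoms at time [t] that meet [D] within the draw [a]: it is adapted one step
   earlier and agrees with [D] once draw [t] is [a]. *)
pose Da := [set w | exists2 w', past t w w' & ij t w' = a /\ D w'].
have -> : D `&` [set w | ij t w = a] = Da `&` [set w | ij t w = a].
  apply/seteqP; split=> w [].
    by move=> Dw aw; split=> //; exists w.
  move=> [w' ww' [aw' Dw']] aw; split=> //.
  rewrite -(aD w w')// -(past_succ (@past_refl t w)).
  by split=> //=; rewrite aw' aw.
apply: measurableI => //; apply: IHt => w w' ww'; apply/propext.
split=> -[v wv v_]; exists v => //; apply: past_trans wv => //.
exact: past_sym.
Qed.

Lemma adapted_past t w0 : adapted t (past t w0).
Proof.
move=> w w' ww'; apply/propext; split=> h; last exact: past_trans h ww'.
exact: past_trans h (past_sym ww').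
Qed.

Lemma measurable_past t w0 : measurable (past t w0).
Proof. exact: adapted_measurable (@adapted_past t w0). Qed.

Lemma adapted_comp t U W (g : U -> W) (f : Omega -> U) :
  adapted t f -> adapted t (g \o f).
Proof. by move=> af w w' ww'; rewrite /= (af w). Qed.

Lemma adapted_measurable_fun t (f : Omega -> R) D : adapted t f ->
  measurable_fun D (EFin \o f).
Proof.
move=> af mD Y mY; apply: measurableI => //; apply: (@adapted_measurable t).
exact: (@adapted_comp t _ _ (fun r => Y r%:E)).
Qed.

Local Open Scope ereal_scope.

(* Same as [integral_cst], but its [P D] is the syntactic form produced by other
   lemmas on probabilities, so that it can be rewritten. *)
Lemma integral_cst_prob D (r : \bar R) : measurable D ->
  \int[P]_(w in D) cst r w = r * P D.
Proof. by move=> mD; exact: integral_cst. Qed.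

Lemma integral_past t (f : Omega -> R) w0 : adapted t f ->
  \int[P]_(w in past t w0) (f w)%:E = (f w0)%:E * P (past t w0).
Proof.
move=> af; rewrite -integral_cst_prob; last exact: measurable_past.
by apply: eq_integral => w; rewrite inE => /af ->.
Qed.

Lemma integral_draws t D (f : Omega -> \bar R) : measurable D ->
  measurable_fun D f -> (forall w, D w -> 0 <= f w) ->
  \int[P]_(w in D) f w =
    \sum_(a : T) \int[P]_(w in D `&` [set w | ij t w = a]) f w.
Proof.
move=> mD mf f0; rewrite {1}(cover_draws t D).
rewrite ge0_integral_bigsetU -?cover_draws//.
- by move=> a; exact: measurableI.
- exact: index_enum_uniq.
- by move=> a b _ _ [w [[_ <-] [_ <-]]].
Qed.

(** Draws are removed one at a time: the integral over an atom at [t] is the sum, over the values of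
    draw [t], of integrals over atoms at [t.+1], and at time 0 the only atom is the whole space. [s]
    is separate from [t] since the integrands may depend on draws later than those the atoms fix. *)
Lemma le_integral_past s t D (f g : Omega -> R) :
  measurable D -> adapted s f -> adapted s g ->
  (forall w, 0 <= f w)%R -> (forall w, 0 <= g w)%R ->
  (forall w0, D w0 -> \int[P]_(w in D `&` past t w0) (f w)%:E <=
                      \int[P]_(w in D `&` past t w0) (g w)%:E) ->
  \int[P]_(w in D) (f w)%:E <= \int[P]_(w in D) (g w)%:E.
Proof.
move=> mD af ag f0 g0; elim: t => [|t IHt] h.
  have [/nonemptyPn ->|/contrapT[w Dw]] := pselect (~ (D !=set0)).
    by rewrite !integral_set0.
  have := h w Dw; rewrite (_ : D `&` past 0 w = D)//.
  by apply/seteqP; split=> [? []|].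
apply: IHt => w0 Dw0.
have mDt : measurable (D `&` past t w0).
  by apply: measurableI => //; exact: measurable_past.
rewrite !(integral_draws t mDt); first last.
- by move=> w _; rewrite lee_fin.
- exact: adapted_measurable_fun af.
- by move=> w _; rewrite lee_fin.
- exact: adapted_measurable_fun ag.
apply: lee_sum => a _; rewrite -setIA.
have [/nonemptyPn ->|/contrapT[w1 [Dw1 [h01 <-]]]] :=
    pselect (~ ((D `&` (past t w0 `&` [set w | ij t w = a])) !=set0)).
  by rewrite !integral_set0.
by rewrite past_succ//; exact: h.
Qed.

Lemma condE_le (f : Omega -> R) D k : measurable D -> P D != 0 ->
  (forall w, 0 <= f w)%R ->
  \int[P]_(w in D) (f w)%:E <= k%:E * P D -> (condE P f D <= k)%R.
Proof.
move=> mD PD0 f0 fk.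
have PDfin : P D \is a fin_num by exact: fin_num_measure.
have p0 : (0 < fine (P D))%R.
  by rewrite fine_gt0// lt0e PD0 measure_ge0 ltey_eq PDfin.
have I0 : 0 <= \int[P]_(w in D) (f w)%:E.
  by apply: integral_ge0 => w _; rewrite lee_fin.
move: fk; rewrite -(fineK PDfin) -EFinM => fk.
have Ifin : \int[P]_(w in D) (f w)%:E \is a fin_num.
  by rewrite ge0_fin_numE//; apply: le_lt_trans fk _; rewrite ltry.
by rewrite /condE ler_pdivrMr// -lee_fin fineK.
Qed.

End AdaptedProcess.

(* The draw has the prescribed law only at [active] states; at the others it is
   unconstrained, but the error is then frozen. *)
Section AdaptiveDescent.
Context {R : realType} {T : finType} {d : measure_display}.
Context {Omega : measurableType d} (P : probability Omega R).
Variable ij : nat -> Omega -> T.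
Hypothesis mij : forall t a, measurable [set w | ij t w = a].
Context {St : Type} (step : St -> T -> St) (err rho : St -> R).
Variables (prob : St -> T -> R) (active : pred St) (dom : St -> Prop).
Hypothesis err_ge0 : forall x, 0 <= err x.
Hypothesis err_step : forall x a, err (step x a) <= err x.
Hypothesis err_frozen : forall x a, ~~ active x -> err (step x a) = err x.
Hypothesis dom_step : forall x a, dom x -> dom (step x a).
Hypothesis prob_ge0 : forall x a, 0 <= prob x a.
Hypothesis rho_active : forall x, dom x -> active x ->
  \sum_a prob x a * err (step x a) <= rho x * err x.
Hypothesis rho_frozen : forall x, dom x -> ~~ active x -> err x <= rho x * err x.
Variables (x0 : St) (X : nat -> Omega -> St).
Hypothesis dom0 : dom x0.
Hypothesis X0 : forall w, X 0%N w = x0.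
Hypothesis XS : forall t w, X t.+1 w = step (X t w) (ij t w).
Hypothesis law : forall t w0 a, active (X t w0) ->
  P (past ij t w0 `&` [set w | ij t w = a]) =
    ((prob (X t w0) a)%:E * P (past ij t w0))%E.

Lemma adapted_iterate t : adapted ij t (X t).
Proof.
elim: t => [|t IHt] w w' ww'; first by rewrite !X0.
by rewrite !XS ww'// (IHt w)//; apply: past_leq ww'.
Qed.

Lemma adapted_err t : adapted ij t (fun w => err (X t w)).
Proof. exact: (adapted_comp err (@adapted_iterate t)). Qed.

Lemma dom_iterate t w : dom (X t w).
Proof. by elim: t => [|t IHt]; rewrite ?X0// XS; exact: dom_step. Qed.

Lemma measurable_iterate t x : measurable [set w | X t w = x].
Proof.
apply: (@adapted_measurable _ _ _ _ mij t).
exact: (adapted_comp (fun y => y = x) (@adapted_iterate t)).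
Qed.

Local Open Scope ereal_scope.

Lemma integral_err_step t w0 :
  \int[P]_(w in past ij t w0) (err (X t.+1 w))%:E <=
    (rho (X t w0) * err (X t w0))%:E * P (past ij t w0).
Proof.
set x := X t w0; have mp := measurable_past mij t w0.
have Pfin : P (past ij t w0) \is a fin_num by exact: fin_num_measure.
have p0 : (0 <= fine (P (past ij t w0)))%R by exact: fine_ge0.
have XE w : past ij t w0 w -> X t.+1 w = step x (ij t w).
  by move=> h; rewrite XS (adapted_iterate h).
have [ax|ax] := boolP (active x); last first.
  rewrite (eq_integral (cst (err x)%:E)) => [|w]; last first.
    by rewrite inE => /XE ->; rewrite err_frozen.
  rewrite integral_cst_prob// -(fineK Pfin) -!EFinM lee_fin.
  by rewrite ler_wpM2r// rho_frozen//; exact: dom_iterate.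
rewrite (integral_draws P mij t mp); first last.
- by move=> w _; rewrite lee_fin.
- exact: (adapted_measurable_fun mij (@adapted_err t.+1)).
rewrite (eq_bigr (fun a =>
    (prob x a * err (step x a) * fine (P (past ij t w0)))%:E)).
  rewrite sumEFin -mulr_suml -(fineK Pfin) -EFinM lee_fin ler_wpM2r//.
  by apply: rho_active => //; exact: dom_iterate.
move=> a _; rewrite (eq_integral (cst (err (step x a))%:E)) => [|w].
  rewrite integral_cst_prob; last exact: measurableI.
  by rewrite law// -(fineK Pfin) -!EFinM mulrA [X in (X * _)%R]mulrC.
by rewrite inE => -[/XE -> <-].
Qed.

(** [rho x] alone may be negative where the error vanishes; only the product with the error has a
    sign. *)
Lemma rho_err_ge0 x : dom x -> (0 <= rho x * err x)%R.
Proof.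
move=> dx; have [ax|/(rho_frozen dx)] := boolP (active x); last exact: le_trans.
by apply: le_trans (rho_active dx ax); apply: sumr_ge0 => a _; exact: mulr_ge0.
Qed.

(** The event is a union of atoms at time [t], and the one-step bound has the same constant on each
    of them. *)
Lemma integral_err_step_at t x :
  \int[P]_(w in [set w | X t w = x]) (err (X t.+1 w))%:E <=
    (rho x * err x)%:E * P [set w | X t w = x].
Proof.
have mD := measurable_iterate t x.
have [/nonemptyPn ->|/contrapT[w0 w0x]] :=
    pselect (~ ([set w | X t w = x] !=set0)).
  by rewrite integral_set0 measure0 mule0.
have dx : dom x by rewrite -w0x; exact: dom_iterate.
have r0 := rho_err_ge0 dx.
rewrite -integral_cst_prob//.
apply: (@le_integral_past _ _ _ _ P _ mij t.+1 t _ _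
  (fun=> (rho x * err x)%R)) => //.
  exact: adapted_err.
move=> w1 w1x.
have -> : [set w | X t w = x] `&` past ij t w1 = past ij t w1.
  apply/seteqP; split=> [w []|w h] //; split=> //=.
  by rewrite (adapted_iterate h).
rewrite [leRHS]integral_cst_prob; last exact: measurable_past.
by rewrite -w1x; exact: integral_err_step.
Qed.

Lemma err_iterate_le s t w : (s <= t)%N -> (err (X t w) <= err (X s w))%R.
Proof.
move=> /subnK <-; elim: (t - s)%N => // k IHk.
by apply: le_trans IHk; rewrite addSn XS.
Qed.

(* A nonpositive factor [rho (X k w0)] forces the error to vanish almost surely
   from step [k.+1] on, so that only positive factors have to be divided out. *)
Lemma integral_err_prod n k w0 (c : R) : (0 <= c)%R ->
  {ae P, forall w, past ij k w0 w ->
     (\prod_(k <= i < k + n) rho (X i w) <= c)%R} ->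
  \int[P]_(w in past ij k w0) (err (X (k + n)%N w))%:E <=
    (c * err (X k w0))%:E * P (past ij k w0).
Proof.
elim: n k w0 c => [|n IHn] k w0 c c0 h.
  have ag := adapted_comp (fun x => (c * err x)%R) (@adapted_iterate k).
  rewrite addn0 -(integral_past P mij (f := fun w => (c * err (X k w))%R)).
    (* The empty product gives [1 <= c] only almost everywhere on the atom, and nothing when the
       atom is null; hence the almost-everywhere comparison. *)
    apply: ae_ge0_le_integral.
    - exact: measurable_past.
    - by move=> w _; rewrite lee_fin.
    - exact: (adapted_measurable_fun mij (@adapted_err k)).
    - by move=> w _; rewrite lee_fin mulr_ge0.
    - exact: (adapted_measurable_fun mij ag).
    apply: filterS h => w hw /hw; rewrite addn0 big_geq// => c1.
    by rewrite lee_fin ler_peMl.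
  exact: ag.
have mp := measurable_past mij k w0.
have [r0|r0] := ltP 0%R (rho (X k w0)); last first.
  apply: (@le_trans _ _ (\int[P]_(w in past ij k w0) (err (X k.+1 w))%:E)).
    apply: ge0_le_integral => //.
    - by move=> w _; rewrite lee_fin.
    - exact: (adapted_measurable_fun mij (@adapted_err _)).
    - exact: (adapted_measurable_fun mij (@adapted_err _)).
    - by move=> w _; rewrite lee_fin err_iterate_le// addnS ltnS leq_addr.
  apply: le_trans (integral_err_step k w0) _.
  rewrite lee_wpmul2r// lee_fin; apply: (@le_trans _ _ 0%R).
    by rewrite mulr_le0_ge0.
  exact: mulr_ge0.
(* On this history the factor of index [k] is the constant [r], so the remaining factors have
   product at most [c / r]. The induction hypothesis is applied with [c / r] on each atom at [k.+1],
   and the one-step bound restores [r]. *)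
set r := rho (X k w0) in r0 *.
apply: (@le_trans _ _ (\int[P]_(w in past ij k w0) (c / r * err (X k.+1 w))%:E)).
  have ag := adapted_comp (fun x => (c / r * err x)%R) (@adapted_iterate k.+1).
  apply: (@le_integral_past _ _ _ _ P _ mij (k + n.+1) k.+1 _ _
    (fun w => (c / r * err (X k.+1 w))%R)) => //.
  - exact: adapted_err.
  - by apply: adapted_leq ag; rewrite addnS ltnS leq_addr.
  - by move=> w; rewrite mulr_ge0// divr_ge0// ltW.
  move=> w1 h01.
  have -> : past ij k w0 `&` past ij k.+1 w1 = past ij k.+1 w1.
    apply/seteqP; split=> [w []|w hw] //; split=> //.
    by apply: past_trans h01 _; exact: past_leq hw.
  rewrite [leRHS]integral_past// -addSnnS; apply: IHn.
    by rewrite divr_ge0// ltW.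
  apply: filterS h => w hw hw1; rewrite ler_pdivlMr// mulrC.
  have h0 : past ij k w0 w by apply: past_trans h01 _; exact: past_leq hw1.
  have := hw h0; rewrite big_ltn; last by rewrite addnS ltnS leq_addr.
  by rewrite (adapted_iterate h0) addSnnS.
under eq_integral do rewrite EFinM.
rewrite ge0_integralZl_EFin//; first last.
- by rewrite divr_ge0// ltW.
- exact: (adapted_measurable_fun mij (@adapted_err _)).
- by move=> w _; rewrite lee_fin.
apply: le_trans (lee_wpmul2l _ (integral_err_step k w0)) _.
  by rewrite lee_fin divr_ge0// ltW.
by rewrite muleA -EFinM mulrA divfK ?gt_eqF.
Qed.

Lemma integral_err_prod_on n k (D : set Omega) (c : R) : adapted ij k D ->
  (0 <= c)%R ->
  {ae P, forall w, D w -> (\prod_(k <= i < k + n) rho (X i w) <= c)%R} ->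
  \int[P]_(w in D) (err (X (k + n)%N w))%:E <=
    \int[P]_(w in D) (c * err (X k w))%:E.
Proof.
move=> aD c0 h.
have ag := adapted_comp (fun x => (c * err x)%R) (@adapted_iterate k).
apply: (@le_integral_past _ _ _ _ P _ mij (k + n) k _ _
  (fun w => (c * err (X k w))%R)) => //.
- exact: adapted_measurable aD.
- exact: adapted_err.
- by apply: adapted_leq ag; exact: leq_addr.
- by move=> w; rewrite mulr_ge0.
move=> w0 Dw0.
have pD w : past ij k w0 w -> D w by move=> /aD ->.
have -> : D `&` past ij k w0 = past ij k w0.
  by apply/seteqP; split=> [w []|w hw] //; split=> //; exact: pD.
rewrite [leRHS]integral_past//; apply: integral_err_prod => //.
by apply: filterS h => w hw /pD.
Qed.

Lemma condE_err_step t x : P [set w | X t w = x] != 0 ->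
  (condE P (fun w => err (X t.+1 w)) [set w | X t w = x] <= rho x * err x)%R.
Proof.
move=> P0; apply: condE_le => //; first exact: measurable_iterate.
exact: integral_err_step_at.
Qed.

Lemma condE_err_prod n k x (c : R) : P [set w | X k w = x] != 0 -> (0 <= c)%R ->
  {ae P, forall w, X k w = x -> (\prod_(k <= i < k + n) rho (X i w) <= c)%R} ->
  (condE P (fun w => err (X (k + n)%N w)) [set w | X k w = x] <= c * err x)%R.
Proof.
move=> P0 c0 h; have mD := measurable_iterate k x; apply: condE_le => //.
rewrite -integral_cst_prob//.
apply: le_trans (integral_err_prod_on _ c0 h) _.
  exact: (adapted_comp (fun y => y = x) (@adapted_iterate k)).
rewrite le_eqVlt; apply/orP; left; apply/eqP/eq_integral => w.
by rewrite inE => /= ->.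
Qed.

Lemma condE_err_prod_initial n k (c : R) : (0 <= c)%R ->
  {ae P, forall w, (\prod_(k <= i < k + n) rho (X i w) <= c)%R} ->
  (condE P (fun w => err (X (k + n)%N w)) [set w | X 0%N w = x0] <=
   c * condE P (fun w => err (X k w)) [set w | X 0%N w = x0])%R.
Proof.
move=> c0 h; have -> : [set w | X 0%N w = x0] = setT.
  by apply/seteqP; split=> // w _; exact: X0.
have mk := @adapted_measurable_fun _ _ _ _ _ mij k _ setT (@adapted_err k).
apply: condE_le => //; first by rewrite probability_setT onee_neq0.
apply: le_trans (integral_err_prod_on (D := setT) _ c0 _) _ => //.
  by apply: filterS h.
under eq_integral do rewrite EFinM.
rewrite ge0_integralZl_EFin//; last by move=> w _; rewrite lee_fin.
rewrite /condE probability_setT divr1 mule1 EFinM fineK//.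
(* [fine] is faithful on finite values only; the mean error is at most [err x0] because errors never
   increase. *)
rewrite ge0_fin_numE; last by apply: integral_ge0 => w _; rewrite lee_fin.
apply: (@le_lt_trans _ _ (\int[P]_(w in setT) cst (err x0)%:E w)).
  apply: ge0_le_integral => //; first by move=> w _; rewrite lee_fin.
  by move=> w _; rewrite lee_fin -(X0 w) err_iterate_le.
by rewrite integral_cst_prob// probability_setT mule1 ltry.
Qed.

End AdaptiveDescent.

(** In the product bound each factor is random through its iterate, so [c] ranges over the constants
    dominating the product almost surely. Both sides are conditioned alike: on [X 1 = x], against
    the error of [x], and on the initial iterate, against the conditional mean error of [X 1]. *)
Theorem theorem5 (R : realType) (l m n r s tau zeta qS qV : nat)
  (A : tubal R l m r) (B : tubal R l s n) (C : tubal R l m n)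
  (M : tubal R l r r) (N : tubal R l s s)
  (S : 'I_qS -> tubal R l m tau) (V : 'I_qV -> tubal R l n zeta)
  (Xs X0 : tubal R l r s) (delta2 : R)
  (d : measure_display) (Omega : measurableType d) (P : probability Omega R)
  (ij : nat -> Omega -> 'I_qS * 'I_qV) (X : nat -> Omega -> tubal R l r s)
  (hqS : (0 < qS)%N) (hqV : (0 < qV)%N)
  (hM : tposdef M) (hN : tposdef N)
  (hXs : tprod (tprod A Xs) B = C)
  (hXsR : sketch_range A B M N (vect Xs))
  (hX0R : sketch_range A B M N (vect X0))
  (hdelta2 : is_delta2 A B M N S V delta2)
  (hX : atesp_pr A B C M N S V P X0 ij X) :
  [/\ forall (t : nat) (x : tubal R l r s),
        P [set w | X t w = x] != 0%E ->
        condE P (fun w => normsqF M N (X t.+1 w - Xs)) [set w | X t w = x]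
        <= rho_pr A B C M N S V delta2 x * normsqF M N (x - Xs),
      forall (t : nat) (x : tubal R l r s) (c : R),
        (1 <= t)%N ->
        P [set w | X 1%N w = x] != 0%E ->
        0 <= c ->
        {ae P, forall w, X 1%N w = x ->
          \prod_(1 <= k < t.+1) rho_zero A B C M N S V delta2 (X k w) <= c} ->
        condE P (fun w => normsqF M N (X t.+1 w - Xs)) [set w | X 1%N w = x]
        <= c * normsqF M N (x - Xs)
    & forall (t : nat) (c : R),
        (1 <= t)%N ->
        0 <= c ->
        {ae P, forall w,
          \prod_(1 <= k < t.+1) rho_zero A B C M N S V delta2 (X k w) <= c} ->
        condE P (fun w => normsqF M N (X t.+1 w - Xs)) [set w | X 0%N w = X0]
        <= c * condE P (fun w => normsqF M N (X 1%N w - Xs))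
                     [set w | X 0%N w = X0]].
Proof.
case: hX => mij hX0 hXS law.
pose err (x : tubal R l r s) := normsqF M N (x - Xs).
pose total := total_loss A B C M N S V.
pose step := sketch_step A B C M N S V.
have e0 x : 0 <= err x by exact: err_ge0.
have es x a : err (step x a) = err x - sketch_loss A B C M N S V x a.
  by exact: (err_step hM hN hXs hdelta2).
have f0 x a : 0 <= sketch_loss A B C M N S V x a.
  by exact: (loss_ge0 hM hN hXs hdelta2).
have ele x a : err (step x a) <= err x by rewrite es gerBl.
have efr x a : ~~ (total x != 0) -> err (step x a) = err x.
  by move=> /negPn/eqP t0; rewrite es (loss_total0 hM hN hXs hdelta2)// subr0.
have dS x a : sketch_range A B M N (vect x) ->
    sketch_range A B M N (vect (step x a)).
  exact: in_range_step.
have p0 x a : 0 <= pr_prob A B C M N S V x a.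
  apply: divr_ge0 => //; apply: sumr_ge0 => i _; exact: sumr_ge0.
have ra x : sketch_range A B M N (vect x) -> total x != 0 ->
    \sum_a pr_prob A B C M N S V x a * err (step x a) <=
    rho_pr A B C M N S V delta2 x * err x.
  by move=> xR tx; exact: (mean_err_le hqS hqV hM hN hXs hXsR hdelta2).
have rz x : sketch_range A B M N (vect x) -> total x != 0 ->
    \sum_a pr_prob A B C M N S V x a * err (step x a) <=
    rho_zero A B C M N S V delta2 x * err x.
  move=> xR tx; apply: le_trans (ra x xR tx) _.
  by rewrite ler_wpM2r// (rho_le_zero hqS hqV hM hN hXs hdelta2).
have frz x : sketch_range A B M N (vect x) -> ~~ (total x != 0) ->
    err x <= rho_pr A B C M N S V delta2 x * err x /\
    err x <= rho_zero A B C M N S V delta2 x * err x.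
  move=> xR /negPn/eqP t0.
  exact: (err_le_total0 hqS hqV hM hN hXs hXsR hdelta2).
split.
- move=> t x.
  exact: (condE_err_step mij e0 efr dS p0 ra (fun x xR tx => proj1 (frz x xR tx))
            hX0R hX0 hXS law).
- move=> t x c _ P0 c0 h.
  have := condE_err_prod mij e0 ele efr dS rz
    (fun x xR tx => proj2 (frz x xR tx)) hX0R hX0 hXS law P0 c0 (n := t).
  by rewrite add1n; apply.
- move=> t c _ c0 h.
  have := condE_err_prod_initial mij e0 ele efr dS rz
    (fun x xR tx => proj2 (frz x xR tx)) hX0R hX0 hXS law (n := t) (k := 1%N) c0.
  by rewrite add1n; apply.
Qed.
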